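(* Let $\mathbb{K}$ be a field of characteristic zero. Let $m,k\geq 1$ be integers and let $r$ be an integer with $$r\geq k^2(m+2)-1.$$ Then there exists a nonempty Zariski open subset $U_{k,m,r}\subseteq\mathbb{K}[z]_{\leq r}$ such that, for every $\sigma\in U_{k,m,r}$ and every $k$-tuple of pairwise distinct polynomials $p_1,\dots,p_k\in\mathbb{K}[t]$ of degree $m$, the polynomials $\sigma(p_1),\dots,\sigma(p_k)$ are linearly independent over $\mathbb{K}$ in $\mathbb{K}[t]$.
   Context: $\mathbb{K}[z]_{\leq r}$ denotes the $\mathbb{K}$-vector space of univariate polynomials of degree at most $r$, identified with the affine space $\mathbb{K}^{r+1}$ of coefficients with its Zariski topology. $\sigma(p)$ denotes the composition $\sigma(p(t))$. ''Of degree $m$'' means of degree exactly $m$. *)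

(* Defs.v *)
From mathcomp Require Import all_boot all_algebra.
From mathcomp Require Export mpoly.

Set Implicit Arguments.
Unset Strict Implicit.
Unset Printing Implicit Defensive.

Import GRing.Theory.
Local Open Scope ring_scope.

Section ZariskiTopology.

Variables (K : fieldType) (n : nat).

Definition zero_locus (S : {mpoly K[n]} -> Prop) (x : 'rV[K]_n) : Prop :=
  forall f : {mpoly K[n]}, S f -> f.@[fun i => x 0 i] = 0.

Definition zariski_open (U : 'rV[K]_n -> Prop) : Prop :=
  exists S : {mpoly K[n]} -> Prop, forall x, U x <-> ~ zero_locus S x.

(* [{poly_n K}] is the space of polynomials of degree < n; [rVnpoly] is the
   library's bijection sending a coefficient vector to its polynomial. *)
Definition npoly_zariski_open (U : {poly_n K} -> Prop) : Prop :=
  zariski_open (fun x => U (rVnpoly x)).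

End ZariskiTopology.

(* The library's [free] requires a finite-dimensional space, which
   [{poly K}] is not. *)
Definition linearly_independent (K : fieldType) (V : lmodType K)
    (I : finType) (v : I -> V) : Prop :=
  forall c : I -> K, \sum_i c i *: v i = 0 -> forall i, c i = 0.

(* Main.v *)
Require Import Defs.
From mathcomp Require Import all_boot all_algebra.
From mathcomp Require Import zify.

Set Implicit Arguments.
Unset Strict Implicit.
Unset Printing Implicit Defensive.

Import GRing.Theory.
Local Open Scope ring_scope.

(** A relation [\sum_i c_i sigma(p_i) = 0] is linear in the coefficients of
[sigma]: it reads [\sum_j sigma_j S_j = 0] with [S_j = \sum_i c_i p_i ^ j].
The theorem is a dimension count that compares the rank of this linear system
with the number of parameters on which the system depends.

The rank is at least [N] as soon as [r + 1 >= k N]. Indeed [S_j] satisfies the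
linear recurrence whose characteristic polynomial is [\prod_i (z - p_i)]; its
coefficient of index [l] has degree at most [m (k - l)], and its constant
coefficient has degree exactly [m k]. Hence a bound [deg S_j <= m j - v] on [k]
consecutive indices propagates in both directions to all indices
([power_sum_deg_window]). For the largest such [v], every block of [k]
consecutive indices therefore contains some [j] with [deg S_j = m j - v]
exactly ([power_sum_max_degrees]). A largest [v] exists because the [p_i] are
distinct and [c] is not zero. Picking one such [j] in each of [N] consecutive
blocks gives a triangular minor of size [N] with nonzero diagonal
([det_power_sum_submx_neq0]).

After scaling one coefficient [c_i] to 1, the system depends on
[k (m + 1) + (k - 1) = k (m + 2) - 1] parameters, one less than the rank
[N = k (m + 2)], and [k N = k ^ 2 (m + 2) <= r + 1]. Where a given minor of size
[N] is nonzero, Cramer's rule recovers [N] coordinates of [sigma] from the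
parameters and the other [r + 1 - N] coordinates, so such [sigma] lie in the
image of a rational map from a space of dimension at most [r]. The closure of that
image is a proper subset ([implicitization]): otherwise the polynomials in
[r + 1] variables with all exponents below a large bound would inject into a
space of polynomials in fewer variables, which is too small. So the
bad [sigma] lie on finitely many hypersurfaces, and since an infinite field
admits no nonzero polynomial that vanishes identically
([mpoly_nonvanishing]), the complement of their union is nonempty. *)

(** * Degree bounds *)

Section DegreeBound.

Variable K : fieldType.
Implicit Types (p q : {poly K}) (d e : int).

(** The bound is an integer, so that the zero polynomial is the only one of
negative degree and the bounds [m j - v] below make sense for small [j]. *)
Definition deg_le p d : Prop := forall l : nat, (d < l%:Z)%R -> p`_l = 0.

Lemma deg_le_size p n : (size p <= n.+1)%N -> deg_le p n%:Z.
Proof.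
move=> le_pn l; rewrite ltz_nat => lt_nl; apply: nth_default.
exact: leq_trans lt_nl.
Qed.

Lemma deg_leN p d : deg_le p d -> deg_le (- p) d.
Proof. by move=> pd l ltl; rewrite coefN pd ?oppr0. Qed.

Lemma deg_leB p q d : deg_le p d -> deg_le q d -> deg_le (p - q) d.
Proof. by move=> pd qd l ltl; rewrite coefB pd ?qd ?subr0. Qed.

Lemma deg_le_sum (I : Type) (r : seq I) (P : pred I) (F : I -> {poly K}) d :
  (forall i, P i -> deg_le (F i) d) -> deg_le (\sum_(i <- r | P i) F i) d.
Proof. by move=> Fd l ltl; rewrite coef_sum big1 // => i /Fd ->. Qed.

Lemma deg_leM p q d e : deg_le p d -> deg_le q e -> deg_le (p * q) (d + e).
Proof.
move=> pd qe l ltl; rewrite coefM big1 // => i _.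
have [lt_di|le_id] := boolP (d < (i : nat)%:Z)%R; first by rewrite pd ?mul0r.
rewrite qe ?mulr0 //; have := ltn_ord i; lia.
Qed.

Lemma deg_le_mulIr p q a d :
  size p = a.+1 -> deg_le (p * q) (a%:Z + d) -> deg_le q d.
Proof.
move=> sz_p pqd l lt_dl; have [->|nz_q] := eqVneq q 0; first by rewrite coef0.
have nz_p : p != 0 by rewrite -size_poly_eq0 sz_p.
apply: nth_default; rewrite leqNgt; apply/negP=> lt_lq.
have nz_lc : (p * q)`_(size (p * q)).-1 != 0.
  by rewrite -/(lead_coef _) lead_coef_eq0 mulf_neq0.
case sz_q: (size q) lt_lq => [|b] // lt_lb.
move/eqP: nz_lc; apply; apply: pqd; rewrite size_mul // sz_p sz_q; lia.
Qed.

End DegreeBound.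

(** * Weighted power sums and their recurrence *)

Section PowerSums.

Variables (R : comNzRingType) (k : nat).
Implicit Types (c : 'I_k -> R) (p : 'I_k -> {poly R}).

Definition power_sum c p (j : nat) : {poly R} := \sum_i c i *: p i ^+ j.

(** The characteristic polynomial of the recurrence satisfied by the power sums
of the nodes [p i]. *)
Definition node_poly p : {poly {poly R}} := \prod_i ('X - (p i)%:P).

(** Applying the shift operator [Q] to the sequence of power sums multiplies the
weight of each node by the value of [Q] there; this gives both the recurrence
([Q] vanishing at all nodes) and the independence of the nodes ([Q] vanishing at
all nodes but one). *)
Lemma sum_horner_power_sum c p (Q : {poly {poly R}}) a :
  \sum_(l < size Q) Q`_l * power_sum c p (a + l) =
  \sum_i c i *: (p i ^+ a * Q.[p i]).
Proof.
under eq_bigr do rewrite mulr_sumr.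
rewrite exchange_big /=; apply: eq_bigr => i _.
rewrite horner_coef mulr_sumr scaler_sumr; apply: eq_bigr => l _.
by rewrite -scalerAr exprD mulrCA.
Qed.

Lemma size_node_poly p : size (node_poly p) = k.+1.
Proof. by rewrite size_prod_XsubC /index_enum -enumT size_enum_ord. Qed.

Lemma power_sum_recurrence c p a :
  \sum_(l < k.+1) (node_poly p)`_l * power_sum c p (a + l) = 0.
Proof.
have := sum_horner_power_sum c p (node_poly p) a; rewrite size_node_poly => ->.
apply: big1 => i _; rewrite horner_prod (bigD1 i) //= hornerXsubC subrr.
by rewrite mul0r mulr0 scaler0.
Qed.

End PowerSums.

(** * Degrees of power sums *)

Section Rank.

Variables (K : fieldType) (k m : nat) (c : 'I_k -> K) (p : 'I_k -> {poly K}).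
Hypothesis size_p : forall i, size (p i) = m.+1.

Local Notation S := (power_sum c p).
Local Notation chi := (node_poly p).

(** Lagrange interpolation: the polynomial that vanishes at all nodes except
[p i] has degree [k - 1], so it isolates [c i] from the first [k] power sums. *)
Lemma power_sum_inj_eq0 : injective p -> (forall j, (j < k)%N -> S j = 0) ->
  forall i, c i = 0.
Proof.
move=> inj_p S0 i; pose Q := \prod_(l | l != i) ('X - (p l)%:P).
have szQ : (size Q <= k)%N.
  rewrite /Q -big_filter size_prod_XsubC size_filter -sum1_count.
  rewrite (eq_bigl (mem (predC1 i))) // sum1_card cardC1 card_ord.
  by rewrite prednK // (leq_trans _ (ltn_ord i)).
have : \sum_(l < size Q) Q`_l * S (0 + l) = 0.
  by apply: big1 => l _; rewrite S0 ?mulr0 // (leq_trans (ltn_ord l)).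
rewrite sum_horner_power_sum (bigD1 i) //= big1 ?addr0 => [|l ne_li].
  rewrite mul1r => /eqP; rewrite scaler_eq0 => /orP[/eqP//|].
  rewrite horner_prod prodf_seq_eq0 => /hasP[l _ /andP[ne_li]].
  by rewrite hornerXsubC subr_eq0 => /eqP/inj_p/esym/eqP; rewrite (negPf ne_li).
by rewrite mul1r horner_prod (bigD1 l) //= hornerXsubC subrr mul0r scaler0.
Qed.

(** Up to sign, the coefficient is the elementary symmetric polynomial of degree
[k - l] in the nodes. *)
Lemma deg_le_node_poly l : deg_le chi`_l (m%:Z * (k%:Z - l%:Z)).
Proof.
(* The induction is on the list of nodes, for all [l] at once. *)
have gen : forall (r : seq 'I_k) l, deg_le (\prod_(i <- r) ('X - (p i)%:P))`_l
    (m%:Z * ((size r)%:Z - l%:Z)).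
  elim=> [|i r IHr] n.
    rewrite big_nil coef1; case: n => [|n] /= l' ltl.
      by rewrite coef1; case: l' ltl => //; lia.
    by rewrite coef0.
  rewrite big_cons mulrBl coefB coefXM coefCM; apply: deg_leB.
    case: n => [|n] /=; first by move=> ? _; rewrite coef0.
    by have := IHr n; congr (deg_le _ _); lia.
  have := deg_leM (deg_le_size (eq_leq (size_p i))) (IHr n).
  by congr (deg_le _ _) => /=; lia.
have sz : size (index_enum 'I_k) = k.
  by rewrite /index_enum -enumT size_enum_ord.
by have := gen (index_enum 'I_k) l; rewrite sz.
Qed.

Lemma size_node_poly0 : size chi`_0 = (m * k).+1.
Proof.
rewrite -horner_coef0 horner_prod.
under eq_bigr do rewrite hornerXsubC sub0r.
rewrite size_prod => [|i _]; last by rewrite oppr_eq0 -size_poly_eq0 size_p.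
under eq_bigr do rewrite size_polyN size_p.
by rewrite sum_nat_const card_ord; lia.
Qed.

Lemma node_poly_coefk : chi`_k = 1.
Proof.
by have := monic_prod_XsubC (index_enum 'I_k) xpredT p;
   rewrite monicE lead_coefE size_node_poly => /eqP.
Qed.

(** The recurrence is homogeneous when [S_j] is given weight [m j]. The leading
coefficient 1 moves the bound one index up. The constant coefficient has degree
exactly [m k], so it can be divided out without loss, which moves the bound one
index down. *)
Lemma power_sum_deg_window v a :
  (forall i, (i < k)%N -> deg_le (S (a + i)) ((m * (a + i))%:Z - v)) ->
  forall j, deg_le (S j) ((m * j)%:Z - v).
Proof.
pose W b := forall i, (i < k)%N -> deg_le (S (b + i)) ((m * (b + i))%:Z - v).
have rec b := power_sum_recurrence c p b.
have up b : W b -> W b.+1.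
  move=> Wb i lt_ik; rewrite addSnnS.
  have [/Wb//|le_ki] := ltnP i.+1 k.
  have eq_ik : i.+1 = k by lia.
  rewrite eq_ik; have /eqP := rec b; rewrite big_ord_recr /= node_poly_coefk.
  rewrite mul1r addrC addr_eq0 => /eqP ->; apply/deg_leN/deg_le_sum => l _.
  have := deg_leM (@deg_le_node_poly l) (Wb l (ltn_ord l)).
  by congr (deg_le _ _); lia.
have down b : W b.+1 -> W b.
  move=> Wb [|i] lt_ik; last by rewrite -addSnnS; apply: Wb; apply: ltnW.
  apply: (deg_le_mulIr size_node_poly0); have /eqP := rec b.
  rewrite big_ord_recl /= addr_eq0 addn0 => /eqP ->.
  apply/deg_leN/deg_le_sum => l _; rewrite /bump /= add1n.
  have := deg_leM (@deg_le_node_poly l.+1) (Wb l (ltn_ord l)).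
  by rewrite addSnnS; congr (deg_le _ _); lia.
move=> Wa j; have W0 : W 0%N by elim: a Wa => // b IHb /down.
have Wj : W j by elim: j => // b /up.
have [k_gt0|] := ltnP 0 k; first by rewrite -[j]addn0; apply: Wj.
rewrite leqn0 => /eqP k0 l _; rewrite /power_sum big1 ?coef0 // => i _.
by have := ltn_ord i; rewrite [X in (_ < X)%N]k0.
Qed.

(** The defect [v] is the least value of [m j - deg S_j] over the first [k]
indices. If the bound [m j - v] were strict throughout some window, the stronger
bound would propagate back to the first [k] indices, against the choice of
[v]. *)
Lemma power_sum_max_degrees : injective p -> ~ (forall i, c i = 0) ->
  exists v : nat, [/\ (v <= m * k)%N,
    forall j l, (m * j < l + v)%N -> (S j)`_l = 0
  & forall a, exists j, [/\ (a <= j < a + k)%N, (v <= m * j)%N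
                          & (S j)`_(m * j - v) != 0]].
Proof.
move=> inj_p nz_c.
have sz_S j : (size (S j) <= (m * j).+1)%N.
  apply: leq_trans (size_sum _ _ _) _; apply/bigmax_leqP => i _.
  apply: leq_trans (size_scale_leq _ _) _.
  apply: leq_trans (size_poly_exp_leq _ _) _.
  by rewrite size_p.
pose P v := [exists j : 'I_k, (v <= m * j)%N && ((S j)`_(m * j - v) != 0)].
have exP : exists v, P v.
  have /existsP[j nz_Sj] : [exists j : 'I_k, S j != 0].
    apply: contra_notT nz_c; rewrite negb_exists => /forallP S0.
    apply: (power_sum_inj_eq0 inj_p) => j ltjk.
    by have := S0 (Ordinal ltjk); rewrite negbK => /eqP.
  have le_l : ((size (S j)).-1 <= m * j)%N.
    by have := sz_S j; case: (size (S j)).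
  exists (m * j - (size (S j)).-1)%N; apply/existsP; exists j.
  by rewrite leq_subr subKn //= -/(lead_coef _) lead_coef_eq0.
case: (ex_minnP exP) => v /existsP[j0 /andP[le_vj0 nz_j0]] v_min.
have le_v j : deg_le (S j) ((m * j)%:Z - v%:Z).
  apply: (@power_sum_deg_window _ 0) => {}j lt_jk l lt_l.
  have [le_l|] := leqP l (m * j); last first.
    by move=> lt_ml; apply: nth_default; apply: leq_trans lt_ml.
  apply/eqP/negPn/negP => nz_l.
  suff /v_min : P (m * j - l)%N by lia.
  by apply/existsP; exists (Ordinal lt_jk); rewrite leq_subr /= subKn.
exists v; split=> [|j l lt_l|a].
- by apply: leq_trans le_vj0 _; rewrite leq_mul2l ltnW ?orbT.
- by apply: (le_v j); lia.
pose Q (i : 'I_k) := (v <= m * (a + i))%N && ((S (a + i))`_(m * (a + i) - v) != 0).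
have [/existsP[i /andP[le_vi nz_i]]|] := boolP [exists i, Q i].
  by exists (a + i)%N; rewrite leq_addr ltn_add2l ltn_ord.
rewrite negb_exists => /forallP noQ; case/negP: nz_j0; apply/eqP.
apply: (@power_sum_deg_window (v%:Z + 1) a) => [i lt_ik l lt_l|]; last lia.
have := noQ (Ordinal lt_ik); rewrite /Q /= negb_and negbK => nz_l.
have [lt_l'|le_l] := ltnP (m * (a + i)) (l + v); first by apply: le_v; lia.
have eq_l : (l = m * (a + i) - v)%N by lia.
by rewrite eq_l; case/orP: nz_l => [|/eqP//]; lia.
Qed.

End Rank.

(** * Images of rational maps are not dense *)

Section MpolyDegree.

Variables (K : fieldType) (s : nat).
Implicit Types p q : {mpoly K[s]}.

Lemma msize_mul_le p q a b :
  (msize p <= a.+1)%N -> (msize q <= b.+1)%N -> (msize (p * q) <= (a + b).+1)%N.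
Proof.
have [->|nz_p] := eqVneq p 0; first by rewrite mul0r msize0.
have [->|nz_q] := eqVneq q 0; first by rewrite mulr0 msize0.
by rewrite msizeM //; move: (msize p) (msize q) => u w; lia.
Qed.

Lemma msize_exp_le p a j : (msize p <= a.+1)%N -> (msize (p ^+ j) <= (a * j).+1)%N.
Proof.
move=> le_pa; elim: j => [|j IHj]; first by rewrite expr0 msize1.
by rewrite exprS mulnS; apply: msize_mul_le.
Qed.

Lemma msize_prod_le (I : Type) (r : seq I) (F : I -> {mpoly K[s]}) (a : I -> nat) :
  (forall i, msize (F i) <= (a i).+1)%N ->
  (msize (\prod_(i <- r) F i) <= (\sum_(i <- r) a i).+1)%N.
Proof.
move=> leF; elim: r => [|i r IHr]; first by rewrite !big_nil msize1.
by rewrite !big_cons; apply: msize_mul_le.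
Qed.

End MpolyDegree.

Section Implicitization.

Variable K : fieldType.

Definition box_mnm n b (a : {ffun 'I_n -> 'I_b}) : 'X_{1..n} :=
  [multinom (a i : nat) | i < n].

Lemma box_mnm_inj n b : injective (@box_mnm n b).
Proof.
move=> a a' /mnmP eq_a; apply/ffunP => i.
by have := eq_a i; rewrite !mnmE => /val_inj.
Qed.

Lemma box_mnm_surj n b (u : 'X_{1..n}) :
  (mdeg u <= b)%N -> exists a : {ffun 'I_n -> 'I_b.+1}, box_mnm a = u.
Proof.
move=> le_ub; have le_u i : (u i <= b)%N.
  by apply: leq_trans le_ub; rewrite mdegE (bigD1 i) ?leq_addr.
exists [ffun i => inord (u i)]; apply/mnmP => i.
by rewrite mnmE ffunE inordK // ltnS.
Qed.

(** The point [y] is the value at [x] of the rational map [g / h]. Consider the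
polynomials [F] in [n] variables with all exponents below [d]: they form a space
of dimension [d ^ n]. Substituting [g / h] and clearing denominators sends it to
polynomials in [s] variables of degree at most [e n d], where [e] bounds the
degrees of [h] and of the [g i]; these live in dimension
[O(d ^ s)]. For [s < n] and large [d] the substitution has a kernel. *)
Lemma implicitization s n (h : {mpoly K[s]}) (g : 'I_n -> {mpoly K[s]}) :
  (s < n)%N ->
  exists2 F : {mpoly K[n]}, F != 0 &
    forall (x : 'I_s -> K) (y : 'I_n -> K), h.@[x] != 0 ->
      (forall i, h.@[x] * y i = (g i).@[x]) -> F.@[y] = 0.
Proof.
move=> lt_sn.
pose e := maxn (msize h) (\max_i msize (g i)).
have h_e : (msize h <= e.+1)%N by apply: leqW; apply: leq_maxl.
have g_e i : (msize (g i) <= e.+1)%N.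
  by apply/leqW/(leq_trans _ (leq_maxr _ _)); apply: (leq_bigmax i).
(* The value of [d] is what makes [(e n d + 1) ^ s < d ^ n]. *)
pose d := ((e * n).+1 ^ s).+1; pose b := (e * n * d)%N.
have lt_bd : (b.+1 ^ s < d ^ n)%N.
  have le_b : (b.+1 <= d * (e * n).+1)%N by rewrite /b; lia.
  apply: leq_ltn_trans (_ : (d * (e * n).+1) ^ s < _)%N.
    by case: (s) => // s'; rewrite leq_exp2r.
  apply: leq_trans (leq_pexp2l _ lt_sn) => //.
  by rewrite expnMn expnSr ltn_pmul2l ?expn_gt0 // ltnS.
(* [Q a] is the image of the monomial [a], homogenized by powers of [h] so that
   all the images carry the same denominator [h ^ (n d)]. *)
pose Q (a : {ffun 'I_n -> 'I_d}) :=
  h ^+ (\sum_i (d - a i)) * \prod_i g i ^+ a i.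
have Q_b a : (msize (Q a) <= b.+1)%N.
  have := msize_mul_le (msize_exp_le (\sum_i (d - a i)) h_e)
    (msize_prod_le (index_enum _) (fun i => msize_exp_le (a i) (g_e i))).
  congr (_ <= _.+1)%N; rewrite -big_distrr -mulnDr -big_split /=.
  rewrite (eq_bigr (fun=> d)) => [|i _]; last by rewrite subnK // ltnW.
  by rewrite sum_nat_const card_ord mulnA.
pose A := \matrix_(i < #|{ffun 'I_n -> 'I_d}|, j < #|{ffun 'I_s -> 'I_b.+1}|)
  (Q (enum_val i))@_(box_mnm (enum_val j)).
have /rowV0Pn[v /sub_kermxP vA0 nz_v] : kermx A != 0.
  rewrite kermx_eq0 -row_leq_rank -ltnNge; apply: leq_ltn_trans (rank_leq_col _) _.
  by rewrite !card_ffun !card_ord.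
pose F : {mpoly K[n]} := \sum_i v 0 i *: 'X_[box_mnm (enum_val i)].
exists F.
  have /rV0Pn[i nz_vi] := nz_v.
  apply: contraNneq nz_vi => F0; have := mcoeff0 K (box_mnm (enum_val i)).
  rewrite -F0 /F raddf_sum /= (bigD1 i) //= mcoeffZ mcoeffX eqxx mulr1.
  rewrite big1 ?addr0 => [-> //|j ne_ji]; rewrite mcoeffZ mcoeffX.
  by rewrite (inj_eq (@box_mnm_inj _ _)) (inj_eq enum_val_inj) (negPf ne_ji) mulr0.
have vQ0 : \sum_i v 0 i *: Q (enum_val i) = 0.
  apply/mpolyP => u; rewrite mcoeff0 raddf_sum /=.
  have [/box_mnm_surj[a <-]|lt_bu] := leqP (mdeg u) b.
    have /rowP/(_ (enum_rank a)) := vA0; rewrite !mxE => {2}<-.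
    by apply: eq_bigr => i _; rewrite mcoeffZ mxE enum_rankK.
  apply: big1 => i _; rewrite mcoeffZ [_@__](_ : _ = 0) ?mulr0 //.
  apply/eqP; rewrite mcoeff_eq0; apply: msize_mdeg_ge.
  exact: leq_trans (Q_b _) lt_bu.
move=> x y nz_hx hy; apply: (mulfI (expf_neq0 (n * d) nz_hx)).
rewrite mulr0 -[RHS](@meval0 s K x) -vQ0 !raddf_sum /= mulr_sumr.
apply: eq_bigr => i _; rewrite !mevalZ mevalX mulrCA; congr (_ * _).
rewrite /Q mevalM rmorphXn rmorph_prod /=.
rewrite [in RHS](eq_bigr (fun j => h.@[x] ^+ enum_val i j * y j ^+ enum_val i j));
  last by move=> j _; rewrite rmorphXn /= -hy exprMn.
rewrite big_split /= -expr_sum mulrA -exprD -big_split /=.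
congr (_ ^+ _ * _); last by apply: eq_bigr => j _; rewrite mnmE.
rewrite (eq_bigr (fun=> d)) => [|j _]; last by rewrite subnK // ltnW.
by rewrite sum_nat_const card_ord.
Qed.

End Implicitization.

(** Induction on the number of variables: choose the first [n] coordinates so
that some coefficient with respect to the last variable stays nonzero, then the
last coordinate outside the finitely many roots of what remains. *)
Lemma mpoly_nonvanishing (K : fieldType) (charK0 : [pchar K] =i pred0) n
    (F : {mpoly K[n]}) : F != 0 -> exists x : 'I_n -> K, F.@[x] != 0.
Proof.
have nonroot (q : {poly K}) : q != 0 -> exists z, q.[z] != 0.
  move=> nz_q; pose r := [seq i%:R : K | i <- iota 0 (size q)].
  have [/allP rq|/allPn[z _]] := boolP (all (root q) r); last by exists z.
  have uniq_r : uniq r.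
    rewrite map_inj_uniq ?iota_uniq // => i j eq_ij.
    move/pcharf0P: charK0 => K0; wlog le_ij : i j eq_ij / (i <= j)%N.
      by move=> IH; case/orP: (leq_total i j) => [/IH|/IH/esym]; apply.
    apply/eqP; rewrite eqn_leq le_ij andTb -subn_eq0 -K0 natrB //.
    by rewrite eq_ij subrr eqxx.
  have := max_poly_roots nz_q (introT allP rq) uniq_r.
  by rewrite size_map size_iota ltnn.
elim: n F => [|n IHn] F nz_F.
  exists (fun=> 0); apply: contraNneq nz_F; rewrite [F]nvar0_mpolyC mevalC => ->.
  by rewrite mpolyC0.
have [i nz_i] : exists i, (muni F)`_i != 0.
  have [u u_F] : exists u, u \in msupp F.
    have := nz_F; rewrite -msupp_eq0; case E: (msupp F) => [//|u r] _.
    by exists u; rewrite mem_head.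
  exists (u ord_max); move: (u_F); rewrite mcoeff_msupp; apply: contraNneq.
  move=> /mpolyP/(_ [multinom u (widen_ord (leqnSn n) j) | j < n]).
  rewrite mcoeff0 muniE coef_sum raddf_sum /= (bigD1_seq u) //= => <-.
  rewrite big1 ?addr0 => [|w ne_wu].
    by rewrite coefZ coefXn eqxx mulr1 mcoeffZ mcoeffX eqxx mulr1.
  rewrite coefZ coefXn; case: eqP => [eq_max|_]; last by rewrite mulr0 mcoeff0.
  rewrite mulr1 mcoeffZ mcoeffX; case: eqP => [eq_w|_]; last by rewrite mulr0.
  case/eqP: ne_wu; apply/mnmP => j.
  case: (unliftP ord_max j) => [j' ->|-> //].
  have /mnmP/(_ j') := eq_w; rewrite !mnmE.
  by congr (w _ = u _); apply/val_inj; rewrite /= /bump leqNgt ltn_ord.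
have [v nz_v] := IHn _ nz_i.
have [|z nz_z] := nonroot (map_poly (meval v) (muni F)).
  by apply/eqP => /polyP/(_ i)/eqP; rewrite coef_map coef0 (negPf nz_v).
exists (fun i => if unlift ord_max i is Some j then v j else z).
apply: contraNneq nz_z => <-; rewrite muniE raddf_sum horner_sum mevalE.
apply/eqP/eq_bigr => u _.
rewrite /= map_polyZ map_polyXn hornerZ hornerXn /= mevalZ mevalX -mulrA.
congr (_ * _); rewrite [RHS]big_ord_recr /= unlift_none; congr (_ * _).
apply: eq_bigr => j _; rewrite mnmE.
have -> : widen_ord (leqnSn n) j = lift ord_max j.
  by apply/val_inj; rewrite /= /bump leqNgt ltn_ord.
by rewrite liftK.
Qed.

(** * Kernels of a family of linear systems *)

Section KernelFamily.

Variables (K : fieldType) (s n N : nat).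
Variables (M : 'M[{mpoly K[s]}]_(n, N)) (f : 'I_N -> 'I_n).
Hypothesis lt_sN : (s < N)%N.

(** Where the minor on the rows [f] is nonzero, a vector [y] of the left kernel
is determined by [x] and by its coordinates outside [f]. This makes [s + (n - N)]
parameters, fewer than [n], so [implicitization] applies. *)
Lemma kernel_family_not_dense :
  exists2 F : {mpoly K[n]}, F != 0 &
    forall (x : 'I_s -> K) (y : 'rV[K]_n), y *m map_mx (meval x) M = 0 ->
      \det (rowsub f (map_mx (meval x) M)) != 0 -> F.@[fun i => y 0 i] = 0.
Proof.
have [/injectiveP inj_f|/injectivePn[b [b' ne_bb' eq_f]]] := boolP (injectiveb f);
  last first.
  (* Two equal rows: the minor vanishes identically. *)
  exists 1 => [|x y _]; first exact: oner_neq0.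
  rewrite (determinant_alternate ne_bb') ?eqxx // => j.
  by rewrite !mxE eq_f.
pose J := [set f b | b : 'I_N]; pose n0 := #|~: J|.
pose e : 'I_n0 -> 'I_n := fun q => enum_val q.
have card_n0 : (n0 + N = n)%N.
  by rewrite addnC -[n in RHS]card_ord -(cardsC J) card_imset // card_ord.
(* The first [s] of the [s + n0] variables are the parameters [x], the others
   are the coordinates of [y] outside [J]; [u] holds the latter and is 0 on [J]. *)
pose P : {mpoly K[s]} -> {mpoly K[s + n0]} :=
  comp_mpoly [tuple 'X_(lshift n0 i) | i < s].
pose L := map_mx P M; pose B := rowsub f L.
pose u : 'rV[{mpoly K[s + n0]}]_n := \sum_q 'X_(rshift s q) *: delta_mx 0 (e q).
(* Cramer's rule: [\det B *: y] in terms of the parameters. *)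
pose g j := (\det B *: u - u *m L *m \adj B *m rowsub f 1%:M) 0 j.
have [|F nz_F F0] := implicitization (\det B) g (n := n).
  by rewrite -card_n0 addnC ltn_add2l.
exists F => // x y yM0 nz_det.
pose w i := match split i with inl i => x i | inr q => y 0 (e q) end.
have evL : map_mx (meval w) L = map_mx (meval x) M.
  apply/matrixP => i j; rewrite !mxE /P comp_mpoly_meval; apply: meval_eq => l.
  by rewrite tnth_mktuple mevalXU /w (unsplitK (inl l)).
pose uK : 'rV[K]_n := \sum_q y 0 (e q) *: delta_mx 0 (e q).
have evu : map_mx (meval w) u = uK.
  rewrite map_mx_sum; apply: eq_bigr => q _.
  by rewrite map_mxZ map_delta_mx /= mevalXU /w (unsplitK (inr q)).
have evB : map_mx (meval w) B = rowsub f (map_mx (meval x) M).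
  by rewrite map_mxsub evL.
have evh : (\det B).@[w] = \det (rowsub f (map_mx (meval x) M)).
  by rewrite -evB det_map_mx.
have y_split : y = uK + colsub f y *m rowsub f 1%:M.
  rewrite {1}[y]row_sum_delta (bigID (mem J)) /= addrC; congr (_ + _).
    rewrite /uK -(big_enum_val (fun i => y 0 i *: delta_mx 0 i)) /=.
    by apply: eq_bigl => i; rewrite inE.
  rewrite big_imset /=; last by move=> ? ? _ _ /inj_f.
  rewrite mulmx_sum_row; apply: eq_bigr => b _; rewrite mxE; congr (_ *: _).
  by apply/rowP => j; rewrite !mxE eqxx eq_sym.
apply: (F0 w); rewrite evh // => j.
set Mx := map_mx (meval x) M in yM0 nz_det evL evB evh *.
have uM : uK *m Mx = - (colsub f y *m rowsub f Mx).
  apply/eqP; rewrite -addr_eq0 -[Mx in rowsub f Mx]mul1mx -mul_rowsub_mx mulmxA.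
  by rewrite -mulmxDl -y_split yM0.
transitivity
  (map_mx (meval w) (\det B *: u - u *m L *m \adj B *m rowsub f 1%:M) 0 j);
  last by rewrite mxE.
rewrite map_mxB map_mxZ !map_mxM map_mx_adj evL evu evB /= evh map_mxsub map_mx1.
rewrite uM !mulNmx opprK -(mulmxA _ (rowsub f Mx)) mul_mx_adj mul_mx_scalar.
by rewrite -scalemxAl -scalerDr -y_split mxE.
Qed.

End KernelFamily.

(** * Linear relations between compositions *)

Lemma map_power_sum (R R' : comNzRingType) (phi : {rmorphism R -> R'}) k
    (c : 'I_k -> R) (p : 'I_k -> {poly R}) c' p' j :
  (forall i, phi (c i) = c' i) -> (forall i, map_poly phi (p i) = p' i) ->
  map_poly phi (power_sum c p j) = power_sum c' p' j.
Proof.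
move=> phi_c phi_p; rewrite /power_sum rmorph_sum; apply: eq_bigr => i _.
by rewrite /= map_polyZ rmorphXn /= phi_c phi_p.
Qed.

Lemma comp_poly_coef_wide (R : comNzRingType) n (q p : {poly R}) :
  (size q <= n)%N -> q \Po p = \sum_(j < n) q`_j *: p ^+ j.
Proof.
move=> le_qn; rewrite comp_polyE (big_ord_widen n (fun j => q`_j *: p ^+ j)) //.
rewrite big_mkcond; apply: eq_bigr => j _.
by case: ltnP => // /(nth_default 0) ->; rewrite scale0r.
Qed.

(** The column attached to [b'] is the degree that [power_sum_max_degrees]
predicts for the power sum of index [f b']; this choice makes the matrix
triangular when [f] is increasing. *)
Definition power_sum_submx (K : fieldType) k m n N (c : 'I_k -> K)
    (p : 'I_k -> {poly K}) (f : {ffun 'I_N -> 'I_n}) (v : nat) : 'M[K]_N :=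
  \matrix_(b, b') (power_sum c p (f b))`_(m * f b' - v).

(** The normalization [c i0 = 1] is what leaves [k (m + 2) - 1] parameters, one
less than the size of the minor. *)
Lemma relation_locus_not_dense (K : fieldType) k m n (i0 : 'I_k)
    (f : {ffun 'I_(k * (m + 2)) -> 'I_n}) v :
  exists2 F : {mpoly K[n]}, F != 0 &
    forall (c : 'I_k -> K) (p : 'I_k -> {poly K}) (y : 'rV[K]_n),
      c i0 = 1 -> (forall i, (size (p i) <= m.+1)%N) ->
      \sum_j y 0 j *: power_sum c p j = 0 ->
      \det (power_sum_submx m c p f v) != 0 -> F.@[fun i => y 0 i] = 0.
Proof.
(* One variable for each coefficient of each [p i], and one for each [c i] with
   [i != i0]. *)
pose T : finType := (('I_k * 'I_m.+1) + {i : 'I_k | i != i0})%type.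
pose X (t : T) : {mpoly K[#|T|]} := 'X_(enum_rank t).
pose cX i : {mpoly K[#|T|]} := if insub i is Some i' then X (inr i') else 1.
pose pX i := \poly_(l < m.+1) X (inl (i, inord l)).
pose M := \matrix_(j < n, b < k * (m + 2)) (power_sum cX pX j)`_(m * f b - v).
have [|F nz_F F0] := kernel_family_not_dense M f.
  have := ltn_ord i0; rewrite card_sum card_prod !card_ord card_sig cardC1 card_ord.
  by lia.
exists F => // c p y c1 sz_p rel nz_det.
pose val_T (t : T) : K :=
  match t with inl t => (p t.1)`_t.2 | inr i => c (val i) end.
pose x (q : 'I_#|T|) : K := val_T (enum_val q).
have xX (t : T) : (X t).@[x] = val_T t.
  by rewrite /X mevalXU /x enum_rankK.
have ev j : map_poly (meval x) (power_sum cX pX j) = power_sum c p j.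
  apply: map_power_sum => i.
    rewrite /cX; case: insubP => [i' _ <-|]; first by rewrite /= xX.
    by rewrite negbK => /eqP ->; rewrite rmorph1 c1.
  apply/polyP => l; rewrite coef_map coef_poly; case: ltnP => [lt_lm|le_ml].
    by rewrite /= xX /= inordK.
  by rewrite raddf0 nth_default // (leq_trans (sz_p i)).
have evM : map_mx (meval x) M = \matrix_(j, b) (power_sum c p j)`_(m * f b - v).
  by apply/matrixP => j b; rewrite !mxE -ev coef_map.
apply: (F0 x); rewrite evM.
  apply/rowP => b; have := congr1 (fun q : {poly K} => q`_(m * f b - v)) rel.
  rewrite /= coef0 coef_sum => rel_b.
  rewrite mxE [RHS]mxE -[RHS]rel_b; apply: eq_bigr => j _.
  by rewrite !mxE coefZ.
congr (\det _ != 0): nz_det.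
by apply/matrixP => b b'; rewrite !mxE.
Qed.

(** One index of exact degree [m j - v] is taken in each of [N] consecutive
blocks of length [k]. Their degrees increase strictly, so the minor is
triangular with the leading coefficients on its diagonal. *)
Lemma det_power_sum_submx_neq0 (K : fieldType) k m n N (c : 'I_k -> K)
    (p : 'I_k -> {poly K}) :
  (0 < m)%N -> (N * k <= n)%N ->
  (forall i, size (p i) = m.+1) -> injective p -> ~ (forall i, c i = 0) ->
  exists (f : {ffun 'I_N -> 'I_n}) (v : 'I_(m * k).+1),
    \det (power_sum_submx m c p f v) != 0.
Proof.
move=> m_gt0 le_Nn sz_p inj_p nz_c.
have [v [le_v deg_v max_v]] := power_sum_max_degrees sz_p inj_p nz_c.
have pick_f (b : 'I_N) : exists j : 'I_n, [/\ (b * k <= j < b.+1 * k)%N,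
    (v <= m * j)%N & (power_sum c p j)`_(m * j - v) != 0].
  have [j []] := max_v (b * k)%N; rewrite -mulSnr => jP le_vj nz_j.
  have lt_jn : (j < n)%N.
    have /andP[_ lt_jb] := jP; apply: leq_trans lt_jb _.
    by apply: leq_trans le_Nn; rewrite leq_mul2r ltn_ord orbT.
  by exists (Ordinal lt_jn).
have [f fP] := fin_all_exists pick_f.
exists (finfun f), (Ordinal (le_v : v < (m * k).+1)%N).
rewrite det_trig.
  by apply/prodf_neq0 => b _; rewrite mxE ffunE; have [] := fP b.
apply/is_trig_mxP => b b' lt_bb'; rewrite mxE !ffunE /=; apply: deg_v.
have [/andP[_ lt_f] _ _] := fP b; have [/andP[le_f _] le_vf _] := fP b'.
rewrite subnK // ltn_pmul2l //; apply: leq_trans lt_f (leq_trans _ le_f).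
by rewrite leq_mul2r lt_bb' orbT.
Qed.

Theorem theorem2p3 (K : fieldType) (charK0 : [pchar K] =i pred0)
    (m k r : nat) (m_ge1 : (1 <= m)%N) (k_ge1 : (1 <= k)%N)
    (r_ge : (k ^ 2 * (m + 2) - 1 <= r)%N) :
  exists U : {poly_(r.+1) K} -> Prop,
    [/\ npoly_zariski_open U,
        exists sigma, U sigma
      & forall sigma : {poly_(r.+1) K}, U sigma ->
        forall p : 'I_k -> {poly K},
          injective p -> (forall i, size (p i) = m.+1) ->
          linearly_independent (fun i => (sigma : {poly K}) \Po p i)].
Proof.
have le_Nr : (k * (m + 2) * k <= r.+1)%N.
  by move: r_ge; rewrite leq_subLR add1n -mulnn mulnAC.
(* A bad [sigma] is caught by one of finitely many hypersurfaces, according to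
   the scaled index [i0], the rows of the nonzero minor, and the defect [v]. *)
pose I := ('I_k * {ffun 'I_(k * (m + 2)) -> 'I_r.+1} * 'I_(m * k).+1)%type.
have [G nz_G G0] := fin_all_exists2
  (fun t : I => @relation_locus_not_dense K k m r.+1 t.1.1 t.1.2 t.2).
pose F := \prod_t G t.
have nz_F : F != 0 by apply/prodf_neq0 => t _; apply: nz_G.
exists (fun sigma => F.@[fun i => npoly_rV sigma 0 i] != 0); split.
- exists (eq F) => y; rewrite rVnpolyK; split=> [/eqP nz_Fy F0|nFy].
    exact/nz_Fy/F0.
  by apply/eqP => Fy0; apply: nFy => _ <-.
- have [x nz_Fx] := mpoly_nonvanishing charK0 nz_F.
  exists (rVnpoly (\row_i x i)); rewrite rVnpolyK.
  by rewrite (@meval_eq _ _ _ x) // => i; rewrite mxE.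
move=> sigma nz_Fs p inj_p sz_p c rel.
move=> i0; apply/eqP/negPn/negP => nz_i0.
pose c' i := (c i0)^-1 * c i.
have c'1 : c' i0 = 1 by rewrite /c' mulVf.
have [|f [v nz_det]] := det_power_sum_submx_neq0 (c := c') m_ge1 le_Nr sz_p inj_p.
  by move/(_ i0)/eqP; rewrite c'1 oner_eq0.
move: nz_Fs; rewrite rmorph_prod /= => /prodf_neq0/(_ (i0, f, v) isT)/eqP; apply.
apply: (G0 (i0, f, v) c' p (npoly_rV sigma) c'1 _ _ nz_det) => // [i|].
  by rewrite sz_p.
transitivity ((c i0)^-1 *: \sum_i c i *: (sigma \Po p i)); last first.
  by rewrite rel scaler0.
rewrite [RHS]scaler_sumr.
under [LHS]eq_bigr do rewrite /power_sum scaler_sumr.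
rewrite exchange_big; apply: eq_bigr => i _ /=.
rewrite (comp_poly_coef_wide _ (size_npoly sigma)) !scaler_sumr.
by apply: eq_bigr => j _; rewrite mxE !scalerA mulrC.
Qed.
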